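(* Let $R>r>0$ be real numbers and let $\mathcal{T}\subset\mathbb{R}^3$ be the torus with radii $R,r$. For every integer $d\ge 0$, the restrictions to $\mathcal{T}$ of the monomials in $$\mathcal{B}_d=\{x^iy^jz^k:\ i,j,k\in\mathbb{Z}_{\ge 0},\ 0\le i\le 3,\ i+j+k\le d\}$$ form a basis of $\mathcal{H}_d(\mathcal{T})$. Consequently, if $m_d:=\dim\mathcal{H}_d(\mathcal{T})$, then $$m_d=\begin{cases}\dbinom{d+3}{3}, & 0\le d\le 3,\\[2ex] \dbinom{d+3}{3}-\dbinom{d-1}{3}=2(d^2+1), & d\ge 4.\end{cases}$$
   Context: For $R>r>0$, the torus is $$\mathcal{T}=\{(x,y,z)\in\mathbb{R}^3:(\sqrt{x^2+y^2}-R)^2+z^2=r^2\},$$ equivalently the real zero set of $F(x,y,z)=(x^2+y^2+z^2+R^2-r^2)^2-4R^2(x^2+y^2)$. $\mathcal{P}_d(\mathbb{R}^3)$ denotes the space of real polynomials in $x,y,z$ of total degree at most $d$, and $\mathcal{H}_d(\mathcal{T})=\{p|_{\mathcal{T}}:p\in\mathcal{P}_d(\mathbb{R}^3)\}$ is the real vector space of functions on $\mathcal{T}$ obtained by restriction. *)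

(* Defs.v *)
From mathcomp Require Export all_boot all_order all_algebra.
From mathcomp Require Export boolp classical_sets functions reals.
From mathcomp Require Export mpoly.

Set Implicit Arguments.
Unset Strict Implicit.
Unset Printing Implicit Defensive.

Import Order.TTheory GRing.Theory Num.Theory.

Local Open Scope classical_set_scope.
Local Open Scope ring_scope.

(* MathComp's [{vspace vT}], [free] and [\dim] live in a finite-dimensional
   ambient space; here the ambient space is the space of all functions on the
   torus, so the notions below are stated for an arbitrary left module. *)

Definition lin_span (K : fieldType) (U : lmodType K) (I : finType)
    (e : I -> U) : set U :=
  [set \sum_i c i *: e i | c in [set: I -> K]].

Definition lin_free (K : fieldType) (U : lmodType K) (I : finType)
    (e : I -> U) : Prop :=
  forall c : I -> K, \sum_i c i *: e i = 0 -> forall i, c i = 0.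

Definition lin_basis (K : fieldType) (U : lmodType K) (V : set U)
    (I : finType) (e : I -> U) : Prop :=
  lin_free e /\ V = lin_span e.

(* The default value 0 is returned when V has no finite basis; the lemma
   [lin_dimE] shows that otherwise every basis of V has [lin_dim V] elements. *)
Definition lin_dim (K : fieldType) (U : lmodType K) (V : set U) : nat :=
  xget 0%N [set n | exists e : 'I_n -> U, lin_basis V e].

Lemma lin_basis_leq (K : fieldType) (U : lmodType K) (V : set U) (m n : nat)
    (e : 'I_m -> U) (f : 'I_n -> U) :
  lin_basis V e -> lin_basis V f -> (m <= n)%N.
Proof.
move=> [fe Ve] [_ Vf].
have memV (p : nat) (g : 'I_p -> U) (Vg : V = lin_span g) i : V (g i).
  rewrite Vg; exists (fun j => (j == i)%:R) => //.
  rewrite (bigD1 i) //= eqxx scale1r big1 ?addr0 // => j /negPf ->.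
  by rewrite scale0r.
have /choice[a aE] : forall i, exists c, \sum_j c j *: f j = e i.
  by move=> i; have := memV _ e Ve i; rewrite Vf => -[c _ <-]; exists c.
have /choice[b bE] : forall j, exists c, \sum_i c i *: e i = f j.
  by move=> j; have := memV _ f Vf j; rewrite {1}Ve => -[c _ <-]; exists c.
pose A := \matrix_(i, j) a i j; pose B := \matrix_(j, i) b j i.
suff /mulmx1_min : A *m B = 1%:M by [].
apply/matrixP => i k; apply/eqP; rewrite -subr_eq0; apply/eqP.
move: k; apply: fe.
under eq_bigr => k _ do rewrite scalerBl.
rewrite sumrB [X in _ - X](bigD1 i) //= [X in _ - (_ + X)]big1; last first.
  by move=> k /negPf ki; rewrite mxE eq_sym ki scale0r.
rewrite mxE eqxx scale1r addr0 -aE.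
under eq_bigr => k _ do rewrite mxE scaler_suml.
rewrite exchange_big /= -sumrB big1 // => j _.
rewrite -bE scaler_sumr -sumrB big1 // => k _.
by rewrite !mxE scalerA subrr.
Qed.

Lemma lin_dimE (K : fieldType) (U : lmodType K) (V : set U) (I : finType)
    (e : I -> U) : lin_basis V e -> lin_dim V = #|I|.
Proof.
move=> [fe Ve].
have reE (F : I -> U) : \sum_i F i = \sum_(j < #|I|) F (enum_val j).
  by rewrite (reindex _ (onW_bij _ (@enum_val_bij I))).
have be : lin_basis V (fun i : 'I_#|I| => e (enum_val i)).
  split=> [c c0 i|].
    rewrite -[i]enum_valK; apply: (fe (c \o enum_rank)).
    by rewrite reE -[RHS]c0; apply: eq_bigr => j _ /=; rewrite enum_valK.
  rewrite Ve; apply/seteqP; split=> x [c _ <-].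
    by exists (c \o enum_val) => //; rewrite reE.
  exists (c \o enum_rank) => //; rewrite reE.
  by apply: eq_bigr => j _ /=; rewrite enum_valK.
rewrite /lin_dim; case: xgetP => [n _ [f bf]|nb]; last first.
  by case: (nb #|I|); exists (fun i => e (enum_val i)).
by apply/eqP; rewrite eqn_leq (lin_basis_leq bf be) (lin_basis_leq be bf).
Qed.

(* The coordinates x, y, z of u : 'rV_3 are u 0 0, u 0 1 and u 0 2. *)
Definition torus (K : realType) (R r : K) : set 'rV[K]_3 :=
  [set u : 'rV[K]_3 |
    (Num.sqrt (u 0 0 ^+ 2 + u 0 1 ^+ 2) - R) ^+ 2 + u 0 2 ^+ 2
    = r ^+ 2].

Definition restr_torus (K : realType) (R r : K) (p : {mpoly K[3]}) :
    torus R r -> K^o :=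
  fun u => p.@[val u 0].
Arguments restr_torus {K} R r p.

(* [msize p] is 1 + the total degree of p, and 0 if p = 0. *)
Definition Pd (K : realType) (d : nat) : set {mpoly K[3]} :=
  [set p | (msize p <= d.+1)%N].
Arguments Pd : clear implicits.

Definition Hd (K : realType) (R r : K) (d : nat) : set (torus R r -> K^o) :=
  [set restr_torus R r p | p in Pd K d].
Arguments Hd {K} R r d.

(* [m 0], [m 1] and [m 2] are the exponents i, j, k of x^i y^j z^k; the type
   ['X_{1..3 < d.+1}] consists of those with i + j + k <= d. *)
Definition Bd (d : nat) : finType :=
  {m : 'X_{1..3 < d.+1} | (m 0%R <= 3)%N}.

Definition Bd_restr (K : realType) (R r : K) (d : nat) (m : Bd d) :
    torus R r -> K^o :=
  restr_torus R r 'X_[val m].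
Arguments Bd_restr {K} R r {d} m.

(* Main.v *)
(* On the torus F = 0, and F is monic of degree 4 in x, so x^4 can be rewritten
   without raising the total degree until all exponents of x are at most 3.
   Conversely, for 0 < y < R - r and 0 < z < r the line of points (x, y, z)
   meets the torus in four points, two on each of the circles of radii
   R + w and R - w at height z, where w = sqrt (r^2 - z^2).  A combination
   of the monomials that vanishes on the torus has degree at most 3 in x and
   these four roots, so its coefficients, which are polynomials in y and z,
   vanish on an open rectangle and hence identically. *)
Require Import Defs.
From mathcomp Require Import ring lra zify.
Import Order.TTheory GRing.Theory Num.Theory.
Local Open Scope ring_scope.

Set Implicit Arguments.
Unset Strict Implicit.
Unset Printing Implicit Defensive.

(** * Spans in a left module *)

Lemma lin_span0 (K : fieldType) (U : lmodType K) (I : finType) (e : I -> U) :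
  lin_span e 0.
Proof. by exists (fun=> 0) => //; apply: big1 => i _; rewrite scale0r. Qed.

Lemma lin_spanD (K : fieldType) (U : lmodType K) (I : finType) (e : I -> U)
    (f g : U) :
  lin_span e f -> lin_span e g -> lin_span e (f + g).
Proof.
move=> [a _ <-] [b _ <-]; exists (fun i => a i + b i) => //.
by rewrite -big_split; apply: eq_bigr => i _; rewrite scalerDl.
Qed.

Lemma lin_spanZ (K : fieldType) (U : lmodType K) (I : finType) (e : I -> U)
    (c : K) (f : U) :
  lin_span e f -> lin_span e (c *: f).
Proof.
move=> [a _ <-]; exists (fun i => c * a i) => //.
by rewrite scaler_sumr; apply: eq_bigr => i _; rewrite scalerA.
Qed.

Lemma lin_span_gen (K : fieldType) (U : lmodType K) (I : finType) (e : I -> U)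
    (i : I) :
  lin_span e (e i).
Proof.
exists (fun j => (j == i)%:R) => //.
rewrite (bigD1 i) //= eqxx scale1r big1 ?addr0 // => j /negPf ->.
by rewrite scale0r.
Qed.

Lemma lin_span_sum (K : fieldType) (U : lmodType K) (I : finType) (e : I -> U)
    (J : eqType) (s : seq J) (c : J -> K) (f : J -> U) :
  (forall j, j \in s -> lin_span e (f j)) ->
  lin_span e (\sum_(j <- s) c j *: f j).
Proof.
move=> sf; rewrite big_seq_cond; elim/big_rec: _ => [|j g /andP[js _] sg].
  exact: lin_span0.
by apply: lin_spanD => //; apply: lin_spanZ; apply: sf.
Qed.

(** * Univariate polynomials with many roots *)

Lemma poly_seq_eq0 (K : idomainType) (n : nat) (a : nat -> K) (s : seq K) :
  uniq s -> (n <= size s)%N ->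
  {in s, forall t, \sum_(i < n) a i * t ^+ i = 0} ->
  forall i : 'I_n, a i = 0.
Proof.
move=> us ns as0 i.
have/polyP/(_ i) : \poly_(j < n) a j = 0.
  apply: (@roots_geq_poly_eq0 _ _ s) => //.
    by apply/allP => t ts; rewrite rootE horner_poly as0.
  exact: leq_trans (size_poly _ _) ns.
by rewrite coef_poly ltn_ord coef0.
Qed.

Lemma poly_itv_eq0 (K : realFieldType) (e : K) (n : nat) (a : nat -> K) :
  0 < e -> (forall t, 0 < t -> t < e -> \sum_(i < n) a i * t ^+ i = 0) ->
  forall i : 'I_n, a i = 0.
Proof.
(* The points [e / k.+2] with [k < n] are [n] distinct roots strictly between 0 and [e]. *)
move=> e0 ae0; apply: (@poly_seq_eq0 _ _ _ [seq e / k.+2%:R | k <- iota 0 n]).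
- rewrite map_inj_uniq ?iota_uniq // => k l /(mulfI (lt0r_neq0 e0)).
  by move=> /invr_inj /eqP; rewrite eqr_nat => /eqP [].
- by rewrite size_map size_iota.
- move=> _ /mapP[k _ ->]; apply: ae0; first by rewrite divr_gt0.
  by rewrite ltr_pdivrMr // ltr_pMr // ltr1n.
Qed.

(** * Exponent triples and the index set [Bd d] *)

Lemma lift3E :
  (lift ord0 ord0 = 1 :> 'I_3) * (lift ord0 (lift ord0 ord0) = 2 :> 'I_3).
Proof. by split; apply: val_inj. Qed.

Lemma meval3 (K : comNzRingType) (v : 'I_3 -> K) (m : 'X_{1..3}) :
  ('X_[m]).@[v] = v 0 ^+ m 0%R * v 1 ^+ m 1%R * v 2 ^+ m 2%R.
Proof.
by rewrite mevalX !big_ord_recl big_ord0 /= mulr1 mulrA !lift3E.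
Qed.

Lemma mdeg3 (m : 'X_{1..3}) : mdeg m = (m 0%R + m 1%R + m 2%R)%N.
Proof. by rewrite mdegE !big_ord_recl big_ord0 /= addn0 addnA !lift3E. Qed.

Lemma mnm3P (m n : 'X_{1..3}) :
  m 0%R = n 0%R -> m 1%R = n 1%R -> m 2%R = n 2%R -> m = n.
Proof.
move=> e0 e1 e2; apply/mnmP => -[[|[|[|//]]] i3].
- by rewrite (_ : Ordinal i3 = 0) //; apply: val_inj.
- by rewrite (_ : Ordinal i3 = 1) //; apply: val_inj.
- by rewrite (_ : Ordinal i3 = 2) //; apply: val_inj.
Qed.

Definition mnm3 (i j k : nat) : 'X_{1..3} :=
  [multinom nth 0%N [:: i; j; k] l | l < 3].

Lemma Bd_of_exponents (d i j k : nat) : (i <= 3)%N -> (i + j + k <= d)%N ->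
  exists m : Bd d,
    [/\ val m 0%R = i :> nat, val m 1%R = j :> nat & val m 2%R = k :> nat].
Proof.
move=> i3 ijk.
have md : (mdeg (mnm3 i j k) < d.+1)%N by rewrite mdeg3 !mnmE.
have mi : ((BMultinom md : 'X_{1..3}) 0%R <= 3)%N by rewrite mnmE.
by exists (Sub (BMultinom md) mi); rewrite SubK /= !mnmE.
Qed.

(** At most one element of [Bd d] satisfies this predicate. Taking plain natural numbers, it also
    makes sense for triples outside the index set, where it is empty. *)
Definition has_exponents (d i j k : nat) : pred (Bd d) := fun m =>
  [&& val m 0%R == i :> nat, val m 1%R == j :> nat & val m 2%R == k :> nat].
Arguments has_exponents {d} i j k m.

Lemma has_exponents_inj (d : nat) (m n : Bd d) :
  has_exponents (val n 0%R) (val n 1%R) (val n 2%R) m = (m == n).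
Proof.
apply/and3P/eqP => [[/eqP e0 /eqP e1 /eqP e2]|->]; last by rewrite !eqxx.
by do 2!apply: val_inj; apply: mnm3P.
Qed.

Lemma Bd_exponents (d : nat) (m : Bd d) :
  (val m 0%R < 4)%N /\ (val m 0%R + val m 1%R + val m 2%R <= d)%N.
Proof. by split; [exact: valP m | rewrite -mdeg3 -ltnS bmdeg]. Qed.

(** A full box of exponents separates the three variables; triples with [i + j + k > d] contribute
    empty sums. This serves both to count [Bd d] and to read a linear combination as a polynomial in
    x, then y, then z. *)
Lemma sum_Bd (V : nmodType) (d : nat) (F : Bd d -> V) :
  \sum_m F m = \sum_(i < 4) \sum_(j < d.+1) \sum_(k < d.+1)
    \sum_(m | has_exponents i j k m) F m.
Proof.
have lt1 (m : Bd d) : (val m 1%R < d.+1)%N by have [_] := Bd_exponents m; lia.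
have lt2 (m : Bd d) : (val m 2%R < d.+1)%N by have [_] := Bd_exponents m; lia.
rewrite (partition_big (fun m : Bd d => Ordinal (Bd_exponents m).1) predT) //=.
apply: eq_bigr => i _.
rewrite (partition_big (fun m : Bd d => Ordinal (lt1 m)) predT) //=.
apply: eq_bigr => j _.
rewrite (partition_big (fun m : Bd d => Ordinal (lt2 m)) predT) //=.
apply: eq_bigr => k _; apply: eq_bigl => m.
by rewrite -!val_eqE /= -andbA.
Qed.

(** * Counting the index set *)

Lemma card_has_exponents (d : nat) (i : 'I_4) (j k : nat) :
  #|@has_exponents d i j k| = (i + j + k <= d)%N.
Proof.
case: leqP => [|ltd].
  move=> /(@Bd_of_exponents d _ _ _ (ltn_ord i))[n [<- <- <-]].
  rewrite -sum1_card (eq_bigl (pred1 n)) ?big_pred1_eq // => m.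
  exact: has_exponents_inj.
apply: eq_card0 => m; apply/negP => /and3P[/eqP e0 /eqP e1 /eqP e2].
by have [_] := Bd_exponents m; rewrite e0 e1 e2 leqNgt ltd.
Qed.

Lemma sum_ord_leq (n s : nat) : (\sum_(k < n) (s + k < n) = n - s)%N.
Proof.
elim: n => [|n IH] in s *; first by rewrite big_ord0.
case: s => [|s].
  under eq_bigr => k _ do rewrite ltn_ord.
  by rewrite sum1_card card_ord subn0.
(* The last condition, [s.+1 + n < n.+1], is false; the others are those for [s] and [n]. *)
rewrite big_ord_recr /= -[RHS]IH addSn ltnS ltnNge leq_addl addn0.
by apply: eq_bigr.
Qed.

Lemma sum_ord_subn (n s : nat) :
  (\sum_(j < n) (n - (s + j)) = 'C((n - s).+1, 2))%N.
Proof.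
elim: n => [|n IH] in s *; first by rewrite big_ord0.
case: s => [|s].
  (* Reversing the order turns the sum into [1 + ... + n.+1]. *)
  rewrite (reindex_inj rev_ord_inj) -bin2_sum big_mkord /=.
  rewrite [RHS]big_ord_recl add0n.
  apply: eq_bigr => i _ /=.
  by rewrite add0n subSS subSn ?leq_subr ?subKn // -ltnS.
have last0 : (n.+1 - (s.+1 + n) = 0)%N by lia.
rewrite subSS -IH big_ord_recr /= last0 addn0.
by apply: eq_bigr => j _; rewrite addSn subSS.
Qed.

(** For fixed [i <= d], the pairs with [j + k <= d - i] form a triangle. Written with
    [(d.+1 - i).+1], the count is correctly ['C(1, 2) = 0] when [i > d]. *)
Lemma card_Bd (d : nat) :
  #|Bd d| = (\sum_(i < 4) 'C((d.+1 - i).+1, 2))%N.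
Proof.
rewrite -sum1_card sum_Bd.
under eq_bigr => i _.
  under eq_bigr => j _.
    under eq_bigr => k _ do
      rewrite sum1_card card_has_exponents -ltnS.
    rewrite sum_ord_leq; over.
  rewrite sum_ord_subn; over.
(* [sum_Bd] yields a sum in the nmodType of [nat], convertible to [addn]. *)
by [].
Qed.

Lemma card_Bd_small (d : nat) : (d <= 3)%N -> #|Bd d| = 'C(d + 3, 3).
Proof.
by rewrite card_Bd !big_ord_recr big_ord0; case: d => [|[|[|[|]]]].
Qed.

(** Four applications of Pascal's rule lead from ['C(d - 1, 3)] to ['C(d + 3, 3)], and the
    increments are the four summands of [card_Bd]. *)
Lemma card_Bd_large (d : nat) :
  (4 <= d)%N -> #|Bd d| = ('C(d + 3, 3) - 'C(d - 1, 3))%N.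
Proof.
move=> d4; rewrite card_Bd !big_ord_recr big_ord0 /=.
case: d d4 => [|[|[|[|n]]]] // _.
rewrite addn3 subn1 /= !subSS !subn0 !(binS _ 2); lia.
Qed.

Lemma binD3B (d : nat) :
  (4 <= d)%N -> ('C(d + 3, 3) - 'C(d - 1, 3) = 2 * (d ^ 2 + 1))%N.
Proof.
case: d => [|[|[|[|n]]]] // _.
(* After Pascal's rule ['C(n, 3)] cancels; this evaluates the remaining ['C(n, 2)] without division
   or subtraction. *)
have bin2E : ('C(n, 2) * 2 + n = n * n)%N.
  by elim: n => // n; rewrite (binS _ 1) bin1; nia.
by rewrite addn3 subn1 /= !(binS _ 2) !(binS _ 1) !bin1; nia.
Qed.

(** * Reduction modulo the equation of the torus *)

Section Torus.
Variables (K : realType) (R r : K).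
Hypotheses (r_gt0 : 0 < r) (lt_rR : r < R).

Definition torus_mon (i j k : nat) : torus R r -> K^o :=
  fun u => val u 0 0 ^+ i * val u 0 1 ^+ j * val u 0 2 ^+ k.

Lemma restr_torusX (m : 'X_{1..3}) :
  restr_torus R r 'X_[m] = torus_mon (m 0%R) (m 1%R) (m 2%R).
Proof. by apply: funext => u; rewrite /restr_torus meval3. Qed.

(** With [s] the square root of [x^2 + y^2], the torus equation reads
    [x^2 + y^2 + z^2 + R^2 - r^2 = 2 R s]; squaring removes the root. *)
Lemma torus_quartic (u : 'rV[K]_3) : torus R r u ->
  (u 0 0 ^+ 2 + u 0 1 ^+ 2 + u 0 2 ^+ 2 + R ^+ 2 - r ^+ 2) ^+ 2
  = 4 * R ^+ 2 * (u 0 0 ^+ 2 + u 0 1 ^+ 2).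
Proof.
rewrite /torus /=; set q := u 0 0 ^+ 2 + u 0 1 ^+ 2 => tu.
have q_ge0 : 0 <= q by rewrite addr_ge0 ?sqr_ge0.
have := sqr_sqrtr q_ge0; move: (Num.sqrt q) tu => s tu sq.
by rewrite -sq -tu; ring.
Qed.

(** This is [F * x^i y^j z^k = 0] solved for its highest power of x. The monomials on the right have
    x-exponent at most [i.+2] and total degree at most [i + j + k + 4]. *)
Lemma torus_mon_reduce (i j k : nat) : torus_mon i.+4 j k =
  (-2) *: torus_mon i.+2 j.+2 k + (-2) *: torus_mon i.+2 j k.+2
  + (2 * (R ^+ 2 + r ^+ 2)) *: torus_mon i.+2 j k
  + (-1) *: torus_mon i j.+4 k + (-1) *: torus_mon i j k.+4
  + (-2) *: torus_mon i j.+2 k.+2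
  + (2 * (R ^+ 2 + r ^+ 2)) *: torus_mon i j.+2 k
  + (-2 * (R ^+ 2 - r ^+ 2)) *: torus_mon i j k.+2
  + (- (R ^+ 2 - r ^+ 2) ^+ 2) *: torus_mon i j k.
Proof.
apply: funext => u; have := torus_quartic (set_mem (valP u)).
rewrite !fctE /torus_mon /GRing.scale /=.
move: (_ 0 0) (_ 0 1) (_ 0 2) => x y z F0.
apply/eqP; rewrite -subr_eq0; apply/eqP.
transitivity (((x ^+ 2 + y ^+ 2 + z ^+ 2 + R ^+ 2 - r ^+ 2) ^+ 2
  - 4 * R ^+ 2 * (x ^+ 2 + y ^+ 2)) * (x ^+ i * y ^+ j * z ^+ k)).
  by rewrite !exprS; ring.
by rewrite F0 subrr mul0r.
Qed.

Lemma torus_mon_span (d i j k : nat) :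
  (i + j + k <= d)%N -> lin_span (Bd_restr R r (d:=d)) (torus_mon i j k).
Proof.
elim/ltn_ind: i => i IH in j k *.
have [i3 ijk|] := leqP i 3.
  have [m [<- <- <-]] := Bd_of_exponents i3 ijk.
  by rewrite -restr_torusX; exact: lin_span_gen.
case: i IH => [|[|[|[|i]]]] // IH _ ijk; rewrite torus_mon_reduce.
by repeat apply: lin_spanD; apply: lin_spanZ; apply: IH; lia.
Qed.

Lemma Hd_span (d : nat) : Hd R r d = lin_span (Bd_restr R r (d:=d)).
Proof.
apply/seteqP; split=> [_ [p pd <-]|_ [c _ <-]].
  have -> : restr_torus R r p =
      \sum_(m <- msupp p) p@_m *: restr_torus R r 'X_[m].
    rewrite fct_sumE; apply: funext => u.
    rewrite /restr_torus {1}[p]mpolyE raddf_sum.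
    by apply: eq_bigr => m _; rewrite /= mevalZ.
  apply: lin_span_sum => m /msize_mdeg_lt /leq_trans /(_ pd).
  by rewrite ltnS mdeg3 restr_torusX; exact: torus_mon_span.
exists (\sum_m c m *: 'X_[val m]) => /=.
  rewrite /Pd /=; apply: leq_trans (msize_sum _ _ _) _.
  apply/bigmax_leqP => m _; apply: leq_trans (msizeZ_le _ _) _.
  by rewrite msizeX bmdeg.
rewrite fct_sumE; apply: funext => u.
by rewrite /restr_torus raddf_sum; apply: eq_bigr => m _; rewrite /= mevalZ.
Qed.

(** * Linear independence on the torus *)

Lemma torus_fiber (y z : K) : 0 < y -> y < R - r -> 0 < z -> z < r ->
  exists s : seq K, [/\ uniq s, size s = 4%N &
    {in s, forall x, torus R r (\row_i [:: x; y; z]`_i)}].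
Proof.
move=> y0 yRr z0 zr; pose w := Num.sqrt (r ^+ 2 - z ^+ 2).
have w2 : w ^+ 2 = r ^+ 2 - z ^+ 2 by rewrite sqr_sqrtr //; nra.
have w0 : 0 < w by rewrite sqrtr_gt0; nra.
have wr : w < r by nra.
(* Here [v] is the distance of the point to the z-axis, to be taken as [R + w] or [R - w]. *)
have memT v x : 0 <= v -> x ^+ 2 = v ^+ 2 - y ^+ 2 -> (v - R) ^+ 2 = w ^+ 2 ->
    torus R r (\row_i [:: x; y; z]`_i).
  move=> v0 x2 vR; rewrite /torus /= !mxE /= x2 subrK sqrtr_sqr ger0_norm //.
  by rewrite vR w2 subrK.
pose a := Num.sqrt ((R + w) ^+ 2 - y ^+ 2).
pose b := Num.sqrt ((R - w) ^+ 2 - y ^+ 2).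
have a2 : a ^+ 2 = (R + w) ^+ 2 - y ^+ 2 by rewrite sqr_sqrtr //; nra.
have b2 : b ^+ 2 = (R - w) ^+ 2 - y ^+ 2 by rewrite sqr_sqrtr //; nra.
(* Positivity comes from [y < R - r < R - w]. *)
have b0 : 0 < b by rewrite sqrtr_gt0; nra.
have ba : b < a by rewrite ltr_sqrt; nra.
exists [:: a; b; - b; - a]; split=> //.
  have sdesc : sorted >%R [:: a; b; - b; - a] by rewrite /= !andbT; lra.
  by apply: sorted_uniq sdesc; [exact: rev_trans lt_trans | exact: ltxx].
move=> x; rewrite !inE => /or4P[] /eqP ->.
- by apply: (memT (R + w)) => //; [lra|ring].
- by apply: (memT (R - w)) => //; [lra|ring].
- by apply: (memT (R - w)) => //; [lra|rewrite sqrrN|ring].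
- by apply: (memT (R + w)) => //; [lra|rewrite sqrrN|ring].
Qed.

Lemma Bd_restr_free (d : nat) : lin_free (Bd_restr R r (d:=d)).
Proof.
move=> c c0 n.
(* [A i j k] is the coefficient of [x^i y^j z^k], and 0 if no index has these exponents. *)
pose A i j k := \sum_(m | has_exponents i j k m) c m.
have sumE (u : 'rV[K]_3) (Tu : torus R r u) :
    \sum_(i < 4) (\sum_(j < d.+1) (\sum_(k < d.+1) A i j k * u 0 2 ^+ k)
      * u 0 1 ^+ j) * u 0 0 ^+ i = 0.
  pose v : torus R r := SigSub (mem_set Tu).
  rewrite -[RHS](congr1 (fun f => f v) c0) fct_sumE sum_Bd.
  apply: eq_bigr => i _; rewrite mulr_suml; apply: eq_bigr => j _.
  rewrite -mulrA mulr_suml; apply: eq_bigr => k _.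
  rewrite -mulrA mulr_suml; apply: eq_bigr => m /and3P[/eqP <- /eqP <- /eqP <-].
  rewrite fctE /Bd_restr restr_torusX /torus_mon /GRing.scale /=; ring.
have A0 (i : 'I_4) (j k : 'I_d.+1) : A i j k = 0.
  (* The variables are peeled off from the outside: z over the interval from 0 to [r], then y over
     the interval from 0 to [R - r], and last x over the four points of the fiber. *)
  apply: (poly_itv_eq0 (a := A i j) r_gt0) => z z0 zr.
  pose B i' j' := \sum_(k' < d.+1) A i' j' k' * z ^+ k'.
  have Rr0 : 0 < R - r by rewrite subr_gt0.
  apply: (poly_itv_eq0 (a := B i) Rr0) => y y0 yR.
  have [s [us s4 sT]] := torus_fiber y0 yR z0 zr.
  pose C i' := \sum_(j' < d.+1) B i' j' * y ^+ j'.
  apply: (poly_seq_eq0 (a := C) us) => [|x xs]; first by rewrite s4.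
  by have := sumE _ (sT x xs); rewrite !mxE.
have [n0 nd] := Bd_exponents n.
have n1 : (val n 1%R < d.+1)%N by lia.
have n2 : (val n 2%R < d.+1)%N by lia.
have := A0 (Ordinal n0) (Ordinal n1) (Ordinal n2); rewrite /A /=.
by under eq_bigl => m do rewrite has_exponents_inj; rewrite big_pred1_eq.
Qed.

End Torus.

Theorem proposition1 (K : realType) (R r : K) (hr : 0 < r) (hR : r < R)
    (d : nat) :
  lin_basis (Hd R r d) (Bd_restr R r (d:=d)) /\
  ((d <= 3)%N -> lin_dim (Hd R r d) = 'C(d + 3, 3)) /\
  ((4 <= d)%N ->
     lin_dim (Hd R r d) = ('C(d + 3, 3) - 'C(d - 1, 3))%N /\
     ('C(d + 3, 3) - 'C(d - 1, 3))%N = (2 * (d ^ 2 + 1))%N).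
Proof.
have basis : lin_basis (Hd R r d) (Bd_restr R r (d:=d)).
  by split; [exact: Bd_restr_free | exact: Hd_span].
split=> //; rewrite (lin_dimE basis); split=> [|d4]; first exact: card_Bd_small.
by split; [exact: card_Bd_large | exact: binD3B].
Qed.
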